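(* Let $\overline{\Omega}_2$ denote the closure of $\Omega_2$ inside $\Sigma_2\times\Sigma_2^*$. The following hold true. 1. $\Omega_2$ is a discrete and open subspace of $\overline{\Omega}_2$. 2. Its complement $\partial\Omega_2:=\overline{\Omega}_2\setminus\Omega_2$ is contained in $\Sigma_2\times\Sigma_2$ and is homeomorphic to the Cantor space.
   Context: Let $\mathcal{O}_2$ be the Cuntz algebra, the unital $C^*$-algebra generated by two isometries $S_1,S_2$ with $S_1S_1^*+S_2S_2^*=1$. Let $W_2$ be the set of all finite words (including the empty word $\emptyset$) in the alphabet $\{1,2\}$, and let $|\mu|$ be the length of $\mu\in W_2$. For $\mu=\mu_1\cdots\mu_k\in W_2$ put $S_\mu=S_{\mu_1}\cdots S_{\mu_k}$ (with $S_\emptyset=1$) and $P_\mu=S_\mu S_\mu^*$. Let $\mathcal{D}_2$ be the $C^*$-subalgebra of $\mathcal{O}_2$ generated by the projections $P_\mu$, $\mu\in W_2$ (it is commutative). The Thompson group $F$ is realized as the group of all unitaries in $\mathcal{O}_2$ of the form $f=\sum_{(\alpha,\beta)\in\mathcal{J}}S_\alpha S_\beta^*$, where $\mathcal{J}\subseteq W_2\times W_2$ is a finite set which is the graph of a bijection between its set of first coordinates $\mathcal{J}_1$ and its set of second coordinates $\mathcal{J}_2$, with $\sum_{\alpha\in\mathcal{J}_1}P_\alpha=1=\sum_{\beta\in\mathcal{J}_2}P_\beta$, and which is order preserving: for $(\alpha,\beta),(\alpha',\beta')\in\mathcal{J}$, $\alpha$ precedes $\alpha'$ in the lexicographic order if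 and only if $\beta$ precedes $\beta'$. For $f=\sum_{(\alpha,\beta)\in\mathcal{J}}S_\alpha S_\beta^*\in F$ put $$f_0=\sum_{(\alpha,\beta)\in\mathcal{J},\ |\alpha|-|\beta|\in 2\mathbb{Z}}S_\alpha S_\beta^*$$ (this does not depend on the chosen presentation of $f$). Define $\Omega_2=\{f_0f_0^*\mid f\in F\}$, a set of projections in $\mathcal{D}_2$. Let $\mathfrak{T}_2$ be the infinite binary rooted tree with vertices labeled by $W_2$, where the root is $\emptyset$ and the successors of $\alpha$ are $\alpha1$ and $\alpha2$. Let $\Sigma_2$ be the collection of all subtrees of $\mathfrak{T}_2$ containing the root and having no leaves, i.e. if a vertex $\alpha$ belongs to the subtree then at least one of its two successors does. Let $\Sigma_2^*$ be $\Sigma_2$ together with the empty tree. Identifying a subtree with its vertex set, $\Sigma_2^*\subseteq\{0,1\}^{W_2}$ carries the product topology (it is compact and metrizable): $\omega_n\to\omega$ if and only if for each $\alpha\in W_2$, one has $\alpha\in\omega\Leftrightarrow\alpha\in\omega_n$ for all sufficiently large $n$. Each projection $q\in\mathcal{D}_2$ is identified with the tree in $\Sigma_2^*$ consisting of all vertices $\alpha$ with $qP_\alpha\neq0$. The set $\Omega_2$ is regarded as a subset of $\Sigma_2\times\Sigma_2^*$ via the embedding $q\mapsto(q,1-q)$, and $\Sigma_2\times\Sigma_2^*$ has the product topology. *)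

(* Defs.v *)
From HB Require Import structures.
From mathcomp Require Import all_boot all_order all_algebra.
From mathcomp Require Import finmap complex.
From mathcomp Require Import boolp classical_sets functions reals topology normedtype cantor.

Set Implicit Arguments.
Unset Strict Implicit.
Unset Printing Implicit Defensive.

Import Order.TTheory GRing.Theory Num.Theory.
Import numFieldNormedType.Exports.

Local Open Scope classical_set_scope.
Local Open Scope ring_scope.

(* Unital C*-algebras. The norm is a real-valued operation on a complex algebra
   and completeness is stated with Cauchy sequences, because the analysis
   library has no structure joining normed modules and algebras. [GRing.Algebra]
   requires 1 != 0, so the zero algebra is excluded. *)
HB.mixin Record isCStarAlgebra (R : realType) A of GRing.Algebra R[i] A := {
  star : A -> A;
  cnorm : A -> R;
  starK : involutive star;
  starD : {morph star : x y / x + y};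
  starZ : forall (c : R[i]) (x : A), star (c *: x) = (c^*)%C *: star x;
  starM : forall x y : A, star (x * y) = star y * star x;
  cnorm_eq0 : forall x : A, cnorm x = 0 -> x = 0;
  cnormD : forall x y : A, cnorm (x + y) <= cnorm x + cnorm y;
  cnormZ : forall (c : R[i]) (x : A), cnorm (c *: x) = complex.Re `|c| * cnorm x;
  cnormM : forall x y : A, cnorm (x * y) <= cnorm x * cnorm y;
  cnorm_star : forall x : A, cnorm (star x * x) = cnorm x ^+ 2;
  cnorm_complete : forall u : nat -> A,
    (forall e : R, 0 < e -> exists N : nat, forall m n : nat,
       (N <= m)%N -> (N <= n)%N -> cnorm (u m - u n) < e) ->
    exists l : A, cnorm (u n - l) @[n --> \oo] --> 0
}.

#[short(type="cstarAlgType")]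
HB.structure Definition CStarAlgebra (R : realType) :=
  {A of GRing.Algebra R[i] A & isCStarAlgebra R A}.

Section CuntzAlgebra.
Context (R : realType) (A : cstarAlgType R).

Definition cstar_subalgebra (B : set A) : Prop :=
  [/\ B 1,
      forall x y, B x -> B y -> B (x + y) /\ B (x * y),
      forall (c : R[i]) x, B x -> B (c *: x),
      forall x, B x -> B (star x) &
      forall (u : nat -> A) (l : A), (forall n, B (u n)) ->
        cnorm (u n - l) @[n --> \oo] --> (0 : R) -> B l].

(* The letters 1 and 2 are encoded by [false] and [true]; since false < true,
   [seqlexi bool] is the lexicographic order for 1 < 2. *)
Definition word := seq bool.

(* [A] is the Cuntz algebra O_2 with generating isometries S_1, S_2. Since O_2
   is determined up to isomorphism by these properties, it is presented through
   an arbitrary such [A] and [S]. *)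
Definition is_cuntz2 (S : bool -> A) : Prop :=
  [/\ forall i, star (S i) * S i = 1,
      S false * star (S false) + S true * star (S true) = 1 &
      forall B : set A, cstar_subalgebra B -> (forall i, B (S i)) -> B = setT].

Variable S : bool -> A.

Definition Sword (mu : word) : A := \prod_(i <- mu) S i.

Definition Pword (mu : word) : A := Sword mu * star (Sword mu).

Definition SS (p : word * word) : A := Sword p.1 * star (Sword p.2).

Definition thompson_index (J : {fset word * word}) : Prop :=
  [/\ {in J &, injective fst} /\ {in J &, injective snd},
      \sum_(a <- [fset p.1 | p in J]%fset) Pword a = 1,
      \sum_(b <- [fset p.2 | p in J]%fset) Pword b = 1 &
      {in J &, forall p q : word * word,
         ((p.1 : seqlexi bool) < q.1)%O = ((p.2 : seqlexi bool) < q.2)%O}].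

Definition presents (J : {fset word * word}) (f : A) : Prop :=
  thompson_index J /\ f = \sum_(p <- J) SS p.

Definition thompsonF : set A :=
  [set f | [/\ star f * f = 1, f * star f = 1 & exists J, presents J f]].

Definition even_part (J : {fset word * word}) : A :=
  \sum_(p <- J | (2 %| (size p.1)%:Z - (size p.2)%:Z)%Z) SS p.

(* [even_part J] is f_0; it depends only on the f presented by [J]. *)
Definition Omega2_proj : set A :=
  [set q | exists f J, [/\ thompsonF f, presents J f &
                           q = even_part J * star (even_part J)]].

(* {0,1}^{W_2} with the product topology. *)
Definition subtrees := prod_topology (fun _ : word => bool).

(* A set of vertices containing the root spans a subtree iff it is closed under
   taking parents. *)
Definition is_subtree (t : subtrees) : Prop :=
  forall (a : word) (i : bool), t (rcons a i) -> t a.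

Definition no_leaves (t : subtrees) : Prop :=
  forall a : word, t a -> t (rcons a false) \/ t (rcons a true).

Definition Sigma2 : set subtrees :=
  [set t : subtrees | [/\ t [::], is_subtree t & no_leaves t]].

Definition Sigma2_star : set subtrees := Sigma2 `|` [set ((fun _ => false) : subtrees)].

Definition tree_of (q : A) : subtrees := fun a => q * Pword a != 0.

Definition Omega2 : set (subtrees * subtrees) :=
  [set (tree_of q, tree_of (1 - q)) | q in Omega2_proj].

(* Closure relative to the subspace Sigma_2 x Sigma_2^*. *)
Definition Omega2_closure : set (subtrees * subtrees) :=
  closure Omega2 `&` (Sigma2 `*` Sigma2_star).

Definition Omega2_boundary : set (subtrees * subtrees) :=
  Omega2_closure `\` Omega2.

End CuntzAlgebra.

(* A set [D] used as a type below carries the subspace topology. *)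
Definition discrete_subspace (T : topologicalType) (D : set T) : Prop :=
  forall U : set D, open U.

Definition open_subspace (T : topologicalType) (D E : set T) : Prop :=
  D `<=` E /\ open [set x : E | D (set_val x)].

Definition homeomorphic (X Y : topologicalType) : Prop :=
  exists (f : X -> Y) (g : Y -> X),
    [/\ cancel f g, cancel g f, continuous f & continuous g].

(* Main.v *)
(* The cylinder of a word of length d gets the weight (-1)^d modulo 3; since
   2 = -1 modulo 3 this defines an additive measure on clopen subsets of the
   Cantor set, of total mass 1. If f in F pairs the leaves of two finite trees,
   comparing the two total masses shows that the complement of f_0 f_0^* has
   measure 0. Conversely, a sequence of signs is the sequence of depth parities of
   the leaves of some binary tree as soon as its sum is 1 modulo 3 and two
   consecutive signs agree (merge two equal neighbours into the opposite sign), so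
   Omega_2 consists of all clopen sets whose complement has measure 0.
   A closure point of Omega_2 is a pair of closed sets covering the Cantor set. If
   they are disjoint, the pair is determined by finitely many vertices and lies in
   Omega_2; if they meet, modifying a clopen approximation below a common vertex
   realizes any measure. The boundary is thus the space of overlapping covering
   pairs, which is compact, zero-dimensional and has no isolated point. *)
Require Import Defs.
From HB Require Import structures.
From mathcomp Require Import all_boot all_order all_algebra finmap complex.
From mathcomp Require Import boolp classical_sets functions reals topology cantor.

Set Implicit Arguments.
Unset Strict Implicit.
Unset Printing Implicit Defensive.

Import Order.TTheory GRing.Theory Num.Theory.

Local Open Scope classical_set_scope.

(** * Words in the Cuntz algebra *)

Definition comparable_words (a b : word) := prefix a b || prefix b a.

(* The combinatorial content of [\sum_(b <- L) P_b = 1]. *)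
Definition complete_code (L : seq word) :=
  forall a : word, all (fun b => size b <= size a) L ->
    count (fun b => prefix b a) L = 1%N.

Lemma comparable_wordsC (a b : word) :
  comparable_words a b = comparable_words b a.
Proof. by rewrite /comparable_words orbC. Qed.

Lemma comparable_long (a b : word) : size b <= size a ->
  comparable_words a b = prefix b a.
Proof.
move=> leba; rewrite /comparable_words orbC; case: (boolP (prefix b a)) => //=.
move=> nba; apply: contraNF nba => /prefixP[c eb]; move: leba.
by rewrite eb size_cat -{2}(addn0 (size a)) leq_add2l leqn0 => /nilP ->;
  rewrite cats0 prefix_refl.
Qed.

Section CuntzWords.
Local Open Scope ring_scope.
Context (R : realType) (A : cstarAlgType R) (S : bool -> A).
Hypothesis hS : is_cuntz2 S.

Lemma star1 : star (1 : A) = 1.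
Proof. by have := starM (star 1 : A) 1; rewrite mulr1 starK mulr1. Qed.

Lemma star0 : star (0 : A) = 0.
Proof. by apply: (addrI (star 0)); rewrite -starD !addr0. Qed.

Lemma star_sum (I : Type) (r : seq I) (Q : pred I) (F : I -> A) :
  star (\sum_(i <- r | Q i) F i) = \sum_(i <- r | Q i) star (F i).
Proof. by apply: (big_morph _ (@starD _ _) star0). Qed.

Lemma starS_mulS i j : star (S i) * S j = (i == j)%:R.
Proof.
have [iso sum1 _] := hS.
have S0 : star (S false) * S true = 0.
  (* Compressing the relation between [star (S false)] and [S true] gives [x + x = x] for
     [x = star (S false) * S true]. *)
  have := congr1 (fun x => star (S false) * x * S true) sum1.
  rewrite mulrDr !mulrA iso mul1r mulrDl mulr1 -!mulrA iso mulr1.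
  by rewrite -[RHS]addr0 => /addrI.
case: i j => [] [] //=; rewrite ?iso //.
by rewrite -[LHS]starK starM starK S0 star0.
Qed.

Lemma Sword_cat a b : Sword S (a ++ b) = Sword S a * Sword S b.
Proof. by rewrite /Sword big_cat. Qed.

Lemma Sword_cons i a : Sword S (i :: a) = S i * Sword S a.
Proof. by rewrite /Sword big_cons. Qed.

Lemma Sword_nil : Sword S [::] = 1.
Proof. by rewrite /Sword big_nil. Qed.

Lemma Sword_iso a : star (Sword S a) * Sword S a = 1.
Proof.
elim: a => [|i a IH]; first by rewrite Sword_nil mulr1 star1.
by rewrite Sword_cons starM -mulrA (mulrA (star (S _))) starS_mulS eqxx mul1r.
Qed.

Lemma Sword_orth a b : ~~ comparable_words a b ->
  star (Sword S a) * Sword S b = 0.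
Proof.
elim: a b => [|i a IH] [|j b] //=.
rewrite /comparable_words /= (eq_sym j i) -andb_orr !Sword_cons starM -mulrA.
rewrite (mulrA (star (S _))) starS_mulS.
by case: (i == j) => /= [/IH|_]; rewrite ?mul1r // mul0r mulr0.
Qed.

Lemma star_Pword a : star (Pword S a) = Pword S a.
Proof. by rewrite /Pword starM starK. Qed.

Lemma PwordM_prefix a b : prefix a b -> Pword S a * Pword S b = Pword S b.
Proof.
case/prefixP => c ->; rewrite /Pword Sword_cat !mulrA.
by rewrite -(mulrA _ (star _)) Sword_iso mulr1.
Qed.

Lemma PwordM_orth a b : ~~ comparable_words a b -> Pword S a * Pword S b = 0.
Proof.
by move=> /Sword_orth ab; rewrite /Pword -mulrA (mulrA (star _)) ab mul0r mulr0.
Qed.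

Lemma Pword_neq0 a : Pword S a != 0.
Proof.
have : star (Sword S a) * Pword S a * Sword S a = 1.
  by rewrite /Pword -!mulrA Sword_iso mulr1 Sword_iso.
apply: contra_eq_neq => ->; rewrite mulr0 mul0r eq_sym; exact: oner_neq0.
Qed.

Lemma PwordM_neq0 a b : comparable_words a b -> Pword S a * Pword S b != 0.
Proof.
case/orP => [/PwordM_prefix ->|/PwordM_prefix ba]; first exact: Pword_neq0.
by rewrite -[_ * _]starK starM !star_Pword ba star_Pword Pword_neq0.
Qed.

(** Multiply the sum by [Pword S a]: each prefix of [a] contributes [Pword S a] and every other word
    of [L] is orthogonal to it. The count thus acts on a nonzero projection as the scalar 1. *)
Lemma complete_code_sum (L : seq word) :
  \sum_(b <- L) Pword S b = 1 -> complete_code L.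
Proof.
move=> sum1 a aL.
have Pa : (count (fun b => prefix b a) L)%:R *: Pword S a = Pword S a.
  rewrite -{2}[Pword S a]mul1r -sum1 mulr_suml scaler_nat.
  rewrite (eq_big_seq (fun b => if prefix b a then Pword S a else 0)).
    by rewrite -big_mkcond big_const_seq iter_addr_0.
  move=> b bL /=; case: ifPn => [/PwordM_prefix//|nba].
  by apply: PwordM_orth; rewrite comparable_wordsC comparable_long ?(allP aL).
apply/eqP; rewrite -(eqr_nat R[i]) -subr_eq0.
apply: contraT => c0; have := Pword_neq0 a.
rewrite -[Pword S a]scale1r -(mulVf c0) -scalerA scalerBl Pa scale1r.
by rewrite subrr scaler0 eqxx.
Qed.

Definition word_antichain (L : seq word) :=
  {in L &, forall a b, comparable_words a b -> a = b}.

(** The mixed products [SS S p * star (SS S p')] vanish because distinct second coordinates are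
    incomparable, so only the diagonal survives. *)
Lemma SS_sumM (r : seq (word * word)) (Q : pred (word * word)) :
  uniq r -> {in r &, injective snd} ->
  word_antichain [seq p.2 | p <- r] ->
  (\sum_(p <- r | Q p) SS S p) * star (\sum_(p <- r | Q p) SS S p) =
  \sum_(p <- r | Q p) Pword S p.1.
Proof.
move=> ur inj anti; rewrite mulr_suml.
rewrite big_seq_cond [RHS]big_seq_cond; apply: eq_bigr => p /andP[pr Qp].
rewrite star_sum mulr_sumr big_mkcond (bigD1_seq p) //= Qp big_seq_cond.
rewrite [X in _ + X]big1 => [|p' /andP[p'r np]].
  rewrite addr0 /SS starM starK /Pword mulrA -(mulrA (Sword S p.1)).
  by rewrite Sword_iso mulr1.
case: ifP => // _; rewrite /SS starM starK mulrA -(mulrA (Sword S p.1)).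
rewrite Sword_orth ?mulr0 ?mul0r //.
apply: contra np => /anti e; apply/eqP/inj => //.
by apply/esym/e; exact: map_f.
Qed.

Lemma tree_of_code (L : seq word) a : word_antichain L -> uniq L ->
  Defs.tree_of S (\sum_(b <- L) Pword S b) a = has (comparable_words a) L.
Proof.
move=> anti uL; apply/idP/hasP => [|[b bL ab]].
  rewrite /Defs.tree_of; apply: contraPP => nL; apply/negP; rewrite negbK.
  rewrite mulr_suml big_seq big1 // => b bL; apply: PwordM_orth.
  by rewrite comparable_wordsC; apply/negP => ab; apply: nL; exists b.
(* The sum absorbs [Pword S b], hence annihilating [Pword S a] would force
   [Pword S b * Pword S a = 0], against comparability. *)
have Pb : Pword S b * (\sum_(c <- L) Pword S c) = Pword S b.
  rewrite mulr_sumr (bigD1_seq b) //= PwordM_prefix ?prefix_refl //.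
  rewrite big_seq_cond big1 ?addr0 // => c /andP[cL ncb].
  by apply: PwordM_orth; apply: contra ncb => /anti e; apply/eqP/esym/e.
apply/eqP => q0; have := congr1 (fun x => Pword S b * x) q0.
rewrite mulrA Pb mulr0 => /eqP; apply/negP/PwordM_neq0.
by rewrite comparable_wordsC.
Qed.

End CuntzWords.

(** * Words and leaves of binary trees *)

Fixpoint words (n : nat) : seq word :=
  if n is n'.+1 then
    map (cons false) (words n') ++ map (cons true) (words n')
  else [:: [::]].

Lemma mem_words n (a : word) : (a \in words n) = (size a == n).
Proof.
elim: n a => [|n IH] [|i a] //=; first by rewrite mem_cat; apply/norP; split;
  apply/mapP => -[].
rewrite eqSS -IH mem_cat; case: i.
  rewrite mem_map; last by move=> ? ? [].
  by case: mapP => // -[].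
rewrite mem_map; last by move=> ? ? [].
by rewrite orbC; case: mapP => // -[].
Qed.

Lemma words_uniq n : uniq (words n).
Proof.
elim: n => //= n IH; rewrite cat_uniq !map_inj_uniq ?IH /= ?andbT;
  try by move=> ? ? [].
by apply/hasPn => ? /mapP[a _ ->]; apply/mapP => -[].
Qed.

Lemma size_words n : size (words n) = 2 ^ n.
Proof. by elim: n => //= n IH; rewrite size_cat !size_map IH addnn expnS mul2n. Qed.

Lemma count_words_rcons n (p : pred word) :
  count p (words n.+1) = count (fun b => p (rcons b false)) (words n) +
                         count (fun b => p (rcons b true)) (words n).
Proof.
elim: n p => [|n IH] p /=; first by rewrite !addn0.
by rewrite -/(words n.+1) !count_cat !count_map !IH /= addnACA.
Qed.

Lemma count_prefix_words (a : word) n : size a <= n ->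
  count (prefix a) (words n) = 2 ^ (n - size a).
Proof.
elim: n a => [|n IH] [|i a] //=.
  by move=> _; rewrite -size_words -count_predT; apply: eq_count; case.
rewrite ltnS subSS => an; rewrite -IH // count_cat !count_map.
have same j : count (prefix (j :: a) \o cons j) (words n) =
    count (prefix a) (words n) by apply: eq_count => b /=; rewrite eqxx.
have other j : count (prefix (j :: a) \o cons (~~ j)) (words n) = 0.
  by rewrite -(count_pred0 (words n)); apply: eq_count => b; case: j.
by case: i; rewrite same; [rewrite (other true)|rewrite (other false) addn0].
Qed.

(** Two siblings in consecutive positions will receive the same sign, which supplies the repeat
    needed to realize a sign sequence. *)
Lemma words_siblings n : exists (a : word) r,
  size a = n /\ words n.+1 = [:: rcons a false, rcons a true & r].
Proof.
elim: n => [|n [a [r [an e]]]]; first by exists [::], [::].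
exists (false :: a), (map (cons false) r ++ map (cons true) (words n.+1)).
by split; [rewrite /= an|rewrite [LHS]/= -/(words n.+1) {1}e].
Qed.

Lemma complete_code_unique L x y a : complete_code L ->
  all (fun b => size b <= size a) L ->
  x \in L -> y \in L -> prefix x a -> prefix y a -> x = y.
Proof.
move=> cL La xL yL xa ya; have /eqP := cL _ La.
rewrite -size_filter => /eqP; set F := [seq b <- L | prefix b a].
have : x \in F by rewrite mem_filter xa.
have : y \in F by rewrite mem_filter ya.
by case: F => [|z [|]] //; rewrite !inE => /eqP -> /eqP ->.
Qed.

(** Reaches the lengths at which [complete_code] says something, starting from an arbitrary word. *)
Lemma long_extension (L : seq word) (a : word) :
  exists2 b, prefix a b & all (fun c => size c <= size b) L.
Proof.
exists (a ++ nseq (\max_(c <- L) size c) false); first exact: prefix_prefix.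
apply/allP => c cL; rewrite size_cat size_nseq; apply: leq_trans (leq_addl _ _).
exact: leq_bigmax_seq.
Qed.

Lemma complete_code_antichain L : complete_code L -> word_antichain L.
Proof.
move=> cL; suff H : {in L &, forall x y, prefix x y -> x = y}.
  by move=> x y xL yL /orP[/H|/H e]; [exact|apply/esym/e].
move=> x y xL yL xy; have [b yb Lb] := long_extension L y.
by apply: (complete_code_unique cL Lb) => //; apply: prefix_trans yb.
Qed.

Lemma complete_code_uniq L : complete_code L -> uniq L.
Proof.
move=> cL; apply: count_mem_uniq => x.
have [xL|xL] := boolP (x \in L); last by apply/count_memPn.
have [b xb Lb] := long_extension L x.
apply/eqP; rewrite eqn_leq -has_count has_pred1 xL andbT /= -(cL b Lb).
by apply: sub_count => y /eqP ->.
Qed.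

(** * Finite binary trees, their leaves and the parities of leaf depths *)

Inductive btree := Leaf | Node of btree & btree.

Fixpoint leaves (t : btree) : seq word :=
  if t is Node l r then map (cons false) (leaves l) ++ map (cons true) (leaves r)
  else [:: [::]].

Fixpoint full_tree n := if n is n'.+1 then Node (full_tree n') (full_tree n') else Leaf.

Lemma leaves_full_tree n : leaves (full_tree n) = words n.
Proof. by elim: n => //= n ->. Qed.

Lemma leaves_sorted t :
  sorted (fun a b : seqlexi bool => (a < b)%O) (leaves t : seq (seqlexi bool)).
Proof.
rewrite lt_sorted_pairwise; elim: t => //= l IHl r IHr.
rewrite pairwise_cat !pairwise_map; apply/and3P; split.
- apply/allrelP => _ _ /mapP[a _ ->] /mapP[b _ ->].
  by rewrite ltxi_cons.
- by apply: sub_pairwise IHl => a b; rewrite /= ltxi_cons lexx.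
- by apply: sub_pairwise IHr => a b; rewrite /= ltxi_cons lexx.
Qed.

Lemma sum_leaves (R : realType) (A : cstarAlgType R) (S : bool -> A) :
  is_cuntz2 S -> forall t, (\sum_(a <- leaves t) Pword S a = 1)%R.
Proof.
move=> hS; elim=> [|l IHl r IHr] /=.
  by rewrite big_seq1 /Pword Sword_nil mul1r star1.
have sub i (L : seq word) : (\sum_(a <- map (cons i) L) Pword S a =
    S i * (\sum_(a <- L) Pword S a) * star (S i))%R.
  rewrite big_map mulr_sumr mulr_suml; apply: eq_bigr => a _.
  by rewrite /Pword Sword_cons starM !mulrA.
by rewrite big_cat /= !sub IHl IHr !mulr1; case: hS.
Qed.

Fixpoint leaf_parities (t : btree) (b : bool) : seq bool :=
  if t is Node l r then leaf_parities l (~~ b) ++ leaf_parities r (~~ b)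
  else [:: b].

Lemma leaf_paritiesE t b :
  leaf_parities t b = [seq b (+) odd (size w) | w <- leaves t].
Proof.
elim: t b => [|l IHl r IHr] b /=; first by rewrite addbF.
by rewrite map_cat -!map_comp IHl IHr; congr (_ ++ _); apply: eq_map => w /=;
  rewrite addbN addNb.
Qed.

(** Attaching a caret to leaf number [i] replaces its parity by two copies of the opposite one. This
    undoes the merging of two equal neighbours. *)
Lemma split_leaf t b i (s := leaf_parities t b) : i < size s ->
  exists t', leaf_parities t' b =
    take i s ++ [:: ~~ nth b s i, ~~ nth b s i & drop i.+1 s].
Proof.
rewrite {}/s; elim: t b i => [|l IHl r IHr] b i /=.
  by case: i => // _; exists (Node Leaf Leaf).
rewrite size_cat take_cat nth_cat drop_cat.
set s1 := leaf_parities l _; set s2 := leaf_parities r _.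
case: (ltnP i (size s1)) => [il _|li].
  have [l' El] := IHl (~~ b) i il; exists (Node l' r) => /=.
  rewrite El -/s2 -catA /= (set_nth_default b) //; case: ltnP => // li.
  have -> : i.+1 = size s1 by apply/eqP; rewrite eqn_leq il li.
  by rewrite subnn drop0 drop_size.
rewrite -ltn_subLR // => ir; have [r' Er] := IHr (~~ b) _ ir.
exists (Node l r') => /=; rewrite Er -/s1 -catA (set_nth_default b) //.
by rewrite ltnNge (leq_trans li) //= subSn.
Qed.

(** * Sign sequences modulo 3 *)

Section SignSum.
Local Open Scope ring_scope.

Definition sign_sum (ys : seq bool) : 'F_3 := \sum_(y <- ys) (-1) ^+ y.

Definition has_repeat (ys : seq bool) := exists u x v, ys = u ++ [:: x, x & v].

(** Holds because [2 = -1] modulo 3: two equal signs add up to the opposite sign. *)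
Lemma sign_sum_merge u x v :
  sign_sum (u ++ ~~ x :: v) = sign_sum (u ++ [:: x, x & v]).
Proof.
rewrite /sign_sum !big_cat /= !big_cons; congr (_ + _).
by rewrite [RHS]addrA; congr (_ + _); case: x; apply/eqP.
Qed.

(* Merging a repeat that has an opposite neighbour creates a new repeat; in a run of
   four equal signs another repeat survives. This leaves [x x], which becomes a
   singleton, and [x x x], whose sum vanishes. *)
Lemma merge_repeat ys : has_repeat ys -> sign_sum ys != 0 ->
  exists u x v, ys = u ++ [:: x, x & v] /\
    (u ++ ~~ x :: v = [:: ~~ x] \/ has_repeat (u ++ ~~ x :: v)).
Proof.
case=> u [x [v ->]]; elim/last_ind: u x v => [|u y IH] x v; last first.
  case: (eqVneq y x) => [->|yx].
    by rewrite cat_rcons => /IH.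
  move=> _; exists (rcons u y), x, v; split=> //; right.
  by exists u, y, v; rewrite cat_rcons; case: (x) (y) yx => [] [].
case: v => [|y v] /=; first by move=> _; exists [::], x, [::]; split=> //; left.
case: (eqVneq y x) => [->|yx]; last first.
  move=> _; exists [::], x, (y :: v); split => //; right; exists [::], y, v.
  by case: (x) (y) yx => [] [].
case: v => [|z v].
  by rewrite /sign_sum !big_cons big_nil; case: (x) => /eqP[]; apply/eqP.
case: (eqVneq z x) => [->|zx] _.
  by exists [::], x, [:: x, x & v]; split=> //; right; exists [:: ~~ x], x, v.
exists [:: x], x, (z :: v); split=> //; right; exists [:: x], z, v.
by case: (x) (z) zx => [] [].
Qed.

(** Induction on the length: merge a repeat, realize the shorter sequence by a tree, then split the
    leaf that carries the merged sign. *)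
Lemma realize_parities ys (b : bool) : has_repeat ys -> sign_sum ys = (-1) ^+ b ->
  exists t, leaf_parities t b = ys.
Proof.
elim: {ys}(size ys) {-2}ys (erefl (size ys)) => [|n IH] ys.
  by move=> /size0nil -> [[|? ?] [? [? ]]].
move=> sys rep sum; have s0 : sign_sum ys != 0 by rewrite sum signr_eq0.
have [u [x [v [eys merged]]]] := merge_repeat rep s0.
have [t Et] : exists t, leaf_parities t b = u ++ ~~ x :: v.
  have sum' : sign_sum (u ++ ~~ x :: v) = (-1) ^+ b.
    by rewrite sign_sum_merge -eys.
  case: merged => [e|rep']; last first.
    apply: IH => //; move/eqP: sys; rewrite eys !size_cat /= !addnS eqSS.
    by move/eqP.
  (* A single sign with sum [(-1) ^+ b] comes from [b] itself, since 1 and -1 differ modulo 3. *)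
  exists Leaf; rewrite e /=; move: sum'; rewrite e /sign_sum big_seq1.
  by case: (x) (b) => [] [] // /eqP.
have [|t' Et'] := @split_leaf t b (size u).
  by rewrite Et size_cat /= addnS ltnS leq_addr.
exists t'; rewrite Et' Et eys take_size_cat // nth_cat ltnn subnn /= negbK.
by rewrite -[u ++ ~~ x :: v]cat_rcons drop_size_cat // size_rcons.
Qed.

End SignSum.

(** * Thompson group elements *)

Lemma even_size_diff (p : word * word) :
  (2 %| ((size p.1)%:Z - (size p.2)%:Z)%R)%Z = (odd (size p.1) == odd (size p.2)).
Proof.
rewrite -intdiv.eqz_mod_dvd !intdiv.modz_nat eqz_nat !modn2.
by case: (odd _) (odd _) => [] [].
Qed.

Notation even_pair p := (odd (size p.1) == odd (size p.2)).

Section ThompsonIndex.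
Local Open Scope ring_scope.
Context (R : realType) (A : cstarAlgType R) (S : bool -> A).
Hypothesis hS : is_cuntz2 S.
Variable J : {fset word * word}.
Hypothesis tJ : thompson_index S J.

Lemma sum_fst : \sum_(p <- J) Pword S p.1 = 1.
Proof. by case: tJ => [[i1 _] <- _ _]; rewrite big_imfset. Qed.

Lemma sum_snd : \sum_(p <- J) Pword S p.2 = 1.
Proof. by case: tJ => [[_ i2] _ <- _]; rewrite big_imfset. Qed.

Lemma complete_fst : complete_code [seq p.1 | p <- J].
Proof. by apply: (complete_code_sum hS); rewrite big_map sum_fst. Qed.

Lemma complete_snd : complete_code [seq p.2 | p <- J].
Proof. by apply: (complete_code_sum hS); rewrite big_map sum_snd. Qed.

Lemma even_part_proj :
  even_part S J * star (even_part S J) =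
  \sum_(p <- J | even_pair p) Pword S p.1.
Proof.
rewrite /even_part (eq_bigl _ _ even_size_diff) (SS_sumM hS) ?fset_uniq //.
  by case: tJ => -[].
exact: (complete_code_antichain complete_snd).
Qed.

Lemma presents_thompsonF f : presents S J f -> thompsonF S f.
Proof.
move=> pf; split; last by exists J.
(* [f] is the adjoint of the sum with exchanged coordinates, so [SS_sumM] yields this unitarity
   relation as well. *)
- case: pf => _ ->; pose swap (p : word * word) := (p.2, p.1).
  have swE : \sum_(p <- J) SS S p =
      star (\sum_(p <- [seq swap p | p <- J]) SS S p).
    rewrite star_sum big_map; apply: eq_bigr => p _.
    by rewrite /SS starM starK.
  rewrite {1}swE starK swE (SS_sumM hS).
  + by rewrite big_map sum_snd.
  + by rewrite map_inj_uniq ?fset_uniq // => -[a b] [c d] [-> ->].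
  + move=> _ _ /mapP[p pJ ->] /mapP[q qJ ->] /= e.
    by case: tJ => -[inj _] _ _ _; rewrite (inj p q pJ qJ e).
  + rewrite -map_comp; exact: (complete_code_antichain complete_fst).
- case: pf => _ ->; rewrite (SS_sumM hS) ?fset_uniq ?sum_fst //.
    by case: tJ => -[].
  exact: (complete_code_antichain complete_snd).
Qed.

Lemma tree_of_sum_fst (Q : pred (word * word)) a :
  Defs.tree_of S (\sum_(p <- J | Q p) Pword S p.1) a =
  has (fun p => Q p && comparable_words a p.1) J.
Proof.
rewrite -big_filter -(big_map fst xpredT (Pword S)) tree_of_code //.
- by rewrite has_map has_filter -filter_predI -has_filter; apply: eq_has => p /=;
    rewrite andbC.
- have anti := complete_code_antichain complete_fst.
  by move=> x y /mapP[p + ->] /mapP[q + ->]; rewrite !mem_filter =>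
    /andP[_ pJ] /andP[_ qJ]; apply: anti; apply: map_f.
- apply: (subseq_uniq (map_subseq _ (filter_subseq _ _))).
  exact: complete_code_uniq complete_fst.
Qed.

Lemma sum_fstC (Q : pred (word * word)) :
  1 - \sum_(p <- J | Q p) Pword S p.1 = \sum_(p <- J | ~~ Q p) Pword S p.1.
Proof. by have := sum_fst; rewrite (bigID Q) /= => <-; rewrite addrAC subrr add0r. Qed.

End ThompsonIndex.

(** The tree pair diagram that matches the leaves of two trees from left to right. *)
Definition zip_leaves (t u : btree) : {fset word * word} :=
  [fset p in zip (leaves t) (leaves u)]%fset.

Lemma leaves_ltxi (t : btree) i j :
  i < size (leaves t) -> j < size (leaves t) ->
  ((nth [::] (leaves t) i : seqlexi bool) < nth [::] (leaves t) j)%O = (i < j).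
Proof.
move=> it jt.
by apply: (lt_sorted_ltn_nth ([::] : seqlexi bool) (leaves_sorted t)).
Qed.

Lemma leaves_uniq (t : btree) : uniq (leaves t).
Proof. exact: (lt_sorted_uniq (leaves_sorted t)). Qed.

Section ZipLeaves.
Variables t u : btree.
Hypothesis tu : size (leaves t) = size (leaves u).

Lemma in_zip_leaves (p : word * word) :
  (p \in zip_leaves t u) = (p \in zip (leaves t) (leaves u)).
Proof. by rewrite !inE. Qed.

Lemma mem_zip_leaves (p : word * word) : p \in zip_leaves t u -> exists2 i,
  i < size (leaves t) & p = (nth [::] (leaves t) i, nth [::] (leaves u) i).
Proof.
rewrite in_zip_leaves => /(nthP ([::], [::])); case=> i.
rewrite size_zip -tu minnn => it <-.
by exists i => //; rewrite nth_zip.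
Qed.

(** Both leaf lists increase lexicographically, so the order in either coordinate is the order of
    the common index. *)
Lemma zip_leaves_thompson (R : realType) (A : cstarAlgType R) (S : bool -> A) :
  is_cuntz2 S -> thompson_index S (zip_leaves t u).
Proof.
move=> hS.
have i1 : {in zip_leaves t u &, injective fst}.
  move=> _ _ /mem_zip_leaves[i it ->] /mem_zip_leaves[j jt ->] /= /eqP.
  by rewrite nth_uniq ?leaves_uniq // => /eqP ->.
have i2 : {in zip_leaves t u &, injective snd}.
  move=> _ _ /mem_zip_leaves[i it ->] /mem_zip_leaves[j jt ->] /= /eqP.
  by rewrite nth_uniq ?leaves_uniq -?tu // => /eqP ->.
have uz : uniq (zip (leaves t) (leaves u)).
  apply: (@map_uniq _ _ fst); rewrite -/(unzip1 _) unzip1_zip ?tu //.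
  exact: leaves_uniq.
have pz : perm_eq (zip_leaves t u) (zip (leaves t) (leaves u)).
  by rewrite uniq_perm ?fset_uniq // => p; rewrite in_zip_leaves.
split=> //.
- rewrite big_imfset //= (perm_big _ pz) /= -(big_map fst xpredT (Pword S)).
  by rewrite -/(unzip1 _) unzip1_zip ?tu // sum_leaves.
- rewrite big_imfset //= (perm_big _ pz) /= -(big_map snd xpredT (Pword S)).
  by rewrite -/(unzip2 _) unzip2_zip ?tu // sum_leaves.
- move=> _ _ /mem_zip_leaves[i it ->] /mem_zip_leaves[j jt ->] /=.
  by rewrite !leaves_ltxi -?tu.
Qed.

End ZipLeaves.

(** Kraft's equality, by double counting: a word of length [n] has exactly one prefix in [L], and
    [b] is a prefix of [2 ^ (n - size b)] such words. *)
Lemma complete_code_kraft L n : complete_code L ->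
  all (fun b => size b <= n) L -> \sum_(b <- L) 2 ^ (n - size b) = 2 ^ n.
Proof.
move=> cL Ln.
rewrite (eq_big_seq (fun b => \sum_(a <- words n) prefix b a : nat)); last first.
  move=> b bL; rewrite -count_prefix_words ?(allP Ln) // -sum1_count.
  by rewrite big_mkcond.
rewrite exchange_big -size_words -sum1_size; apply: eq_big_seq => a.
rewrite mem_words => /eqP an; rewrite -(cL a) ?an // -sum1_count.
by rewrite [RHS]big_mkcond.
Qed.

(** * Masses of codes modulo 3 *)

Section Mod3.
Local Open Scope ring_scope.

Lemma dvdn3E n : (3 %| n)%N = (n%:R == 0 :> 'F_3).
Proof. by rewrite (dvdn_pcharf (pchar_Fp _)). Qed.

Lemma natr_exp2_F3 n : (2 ^ n)%:R = (-1) ^+ n :> 'F_3.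
Proof. by rewrite natrX; congr (_ ^+ n); apply/eqP. Qed.

Lemma natr_exp2_sub_F3 n k : (k <= n)%N ->
  (2 ^ (n - k))%:R = (-1) ^+ n * (-1) ^+ k :> 'F_3.
Proof.
move=> kn; rewrite natr_exp2_F3 -{2}(subnK kn) exprD -mulrA -exprD addnn.
by rewrite -mul2n exprM sqrrN expr1n expr1n mulr1.
Qed.

(** Kraft's equality read modulo 3, where powers of 2 become signs; the common factor [(-1) ^+ n]
    cancels. *)
Lemma complete_code_signs L : complete_code L ->
  \sum_(b <- L) (-1) ^+ size b = 1 :> 'F_3.
Proof.
move=> cL; pose n := (\max_(b <- L) size b)%N.
have Ln : all (fun b => size b <= n)%N L.
  by apply/allP => b bL; exact: leq_bigmax_seq.
have /(congr1 (fun k => k%:R : 'F_3)) := complete_code_kraft cL Ln.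
rewrite natr_sum natr_exp2_F3 (eq_big_seq (fun b => (-1) ^+ n * (-1) ^+ size b)).
  by rewrite -mulr_sumr => /(canRL (signrMK n)) ->; rewrite -expr2 sqrr_sign.
by move=> b bL; rewrite natr_exp2_sub_F3 ?(allP Ln).
Qed.

(* Both coordinates have sign sum 1, even pairs contribute equally to the two sums
   and odd pairs with opposite signs. *)
Lemma odd_pairs_signs (J : seq (word * word)) :
  complete_code [seq p.1 | p <- J] -> complete_code [seq p.2 | p <- J] ->
  \sum_(p <- J | ~~ even_pair p) (-1) ^+ size p.1 = 0 :> 'F_3.
Proof.
move=> /complete_code_signs; rewrite big_map => s1.
move=> /complete_code_signs; rewrite big_map => s2.
have /eqP : \sum_(p <- J) ((-1) ^+ size p.1 - (-1) ^+ size p.2) = 0 :> 'F_3.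
  by rewrite sumrB s1 s2 subrr.
rewrite (bigID (fun p => even_pair p)) /= big1 => [|p /eqP e]; last first.
  by rewrite -[_ ^+ size p.1]signr_odd e signr_odd subrr.
rewrite add0r (eq_bigr (fun p => 2%:R * (-1) ^+ size p.1)); last first.
  move=> p; rewrite -[_ ^+ size p.1]signr_odd -[_ ^+ size p.2]signr_odd.
  by case: (odd _) (odd _) => [] [] // _; apply/eqP.
by rewrite -mulr_sumr mulf_eq0 => /orP[//|/eqP].
Qed.

End Mod3.

(** * Pairs of trees *)

Definition covers (p : subtrees * subtrees) : Prop :=
  [/\ Sigma2 p.1, Sigma2_star p.2 & forall a, p.1 a || p.2 a].

(** For trees without leaves, an overlap at every level amounts by compactness to a common point of
    the two closed sets. *)
Definition overlap (p : subtrees * subtrees) (n : nat) : Prop :=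
  exists2 a : word, size a = n & p.1 a && p.2 a.

(** Every cylinder of level [n] has weight [(-1)^n], so the divisibility says that the second clopen
    set has measure 0 modulo 3. *)
Definition clopen_pair (p : subtrees * subtrees) : Prop :=
  covers p /\ exists2 n, ~ overlap p n & 3 %| count p.2 (words n).

Section Trees.
Variable t : subtrees.
Hypothesis ht : Sigma2_star t.

Lemma star_rcons a i : t (rcons a i) -> t a.
Proof. by case: ht => [[_ st _]|-> //]; exact: st. Qed.

Lemma star_no_leaves a : t a -> exists i, t (rcons a i).
Proof. by case: ht => [[_ _ nl] /nl[]|-> //]; [exists false|exists true]. Qed.

Lemma star_prefix a b : prefix a b -> t b -> t a.
Proof.
case/prefixP => c ->; elim/last_ind: c => [|c i IH]; first by rewrite cats0.
by rewrite -rcons_cat => /star_rcons.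
Qed.

Lemma star_extend a n : size a <= n -> t a ->
  exists b, [/\ size b = n, prefix a b & t b].
Proof.
move=> an ta; rewrite -(subnKC an); elim: (n - size a) => [|k [b [bk ab tb]]].
  by exists a; rewrite addn0 prefix_refl.
have [i ti] := star_no_leaves tb; exists (rcons b i).
by rewrite size_rcons bk addnS; split=> //; exact: prefix_trans (prefix_rcons _ _).
Qed.

End Trees.

Lemma overlap_leq p m n : covers p -> m <= n -> overlap p n -> overlap p m.
Proof.
case=> s1 s2 _ mn [a an /andP[p1 p2]]; exists (take m a).
  by rewrite size_takel // an.
by rewrite !(@star_prefix _ _ (take m a) a) ?prefix_take //; left.
Qed.

Section Disjoint.
Variables (p : subtrees * subtrees) (n : nat).
Hypotheses (cp : covers p) (dp : ~ overlap p n).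

Lemma disjointE a : size a = n -> p.1 a = ~~ p.2 a.
Proof.
case: cp => _ _ cov an; have := cov a; case e1: (p.1 a) => /=; last by move=> ->.
by move=> _; apply/esym/negP => e2; apply: dp; exists a => //; rewrite e1.
Qed.

(** Below a vertex of level [n] only one of the trees survives, and the covering condition forces it
    to contain everything there. *)
Lemma disjoint_extend a b : size a = n -> prefix a b ->
  (p.1 b = p.1 a) * (p.2 b = p.2 a).
Proof.
case: cp => s1 s2 cov an ab; have := disjointE an; have := cov b.
have := @star_prefix _ (or_introl s1) _ _ ab; have := @star_prefix _ s2 _ _ ab.
by case: (p.1 a) (p.2 a) (p.1 b) (p.2 b) => [] [] [] [] // h1 h2 _ _;
  split=> //; rewrite ?h1 ?h2 //; apply/esym; rewrite ?h1 ?h2.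
Qed.

Lemma count_disjoint_succ :
  count p.2 (words n.+1) = (count p.2 (words n)).*2.
Proof.
rewrite count_words_rcons -addnn; congr (_ + _); apply: eq_in_count => a;
  rewrite mem_words => /eqP an; exact: (disjoint_extend an (prefix_rcons _ _)).2.
Qed.

End Disjoint.

(** The count doubles from one level to the next, and 2 is prime to 3. *)
Lemma dvdn3_count_disjoint p n m : covers p -> ~ overlap p n -> n <= m ->
  (3 %| count p.2 (words m)) = (3 %| count p.2 (words n)).
Proof.
move=> cp dp /subnKC <-; elim: (m - n) => [|k IH]; first by rewrite addn0.
rewrite addnS count_disjoint_succ //; first by rewrite -muln2 Gauss_dvdl.
by move=> o; apply/dp/(overlap_leq cp (leq_addr k n)).
Qed.

(** For a Thompson index [J], the tree of the sum of the projections [Pword S r.1] over the pairs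
    [r] selected by [Q], described without the algebra. *)
Definition code_tree (J : seq (word * word)) (Q : pred (word * word)) : subtrees :=
  fun a => has (fun r => Q r && comparable_words a r.1) J.

Lemma prefix_rconsE (T : eqType) (b a : seq T) i :
  prefix b (rcons a i) = prefix b a || (b == rcons a i).
Proof.
apply/idP/orP => [|[ba|/eqP ->]]; last exact: prefix_refl.
  case/prefixP; elim/last_ind => [|d j _]; first by rewrite cats0 => ->; right.
  by rewrite -rcons_cat => /eqP; rewrite eqseq_rcons => /andP[/eqP-> _]; left;
    exact: prefix_prefix.
exact: prefix_trans ba (prefix_rcons _ _).
Qed.

Lemma comparable_words_parent a i c :
  comparable_words (rcons a i) c -> comparable_words a c.
Proof.
rewrite /comparable_words => /orP[/(prefix_trans (prefix_rcons a i)) -> //|].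
rewrite prefix_rconsE => /orP[->|/eqP ->]; first by rewrite orbT.
by rewrite prefix_rcons.
Qed.

Lemma comparable_words_child a c : comparable_words a c ->
  exists i, comparable_words (rcons a i) c.
Proof.
case/orP => [/prefixP[[|i d] ->]|ca].
- exists false; rewrite cats0 /comparable_words orbC prefix_rcons.
  by [].
- by exists i; rewrite -cat_rcons /comparable_words prefix_prefix.
- exists false; rewrite /comparable_words orbC.
  by rewrite (prefix_trans ca (prefix_rcons _ _)).
Qed.

Lemma code_tree_star J Q : Sigma2_star (code_tree J Q).
Proof.
have [hQ|/hasPn hQ] := boolP (has Q J); last first.
  right; apply/funext => a; apply/negbTE/hasPn => r /hQ /negbTE ->.
  by [].
left; split=> [|a i|a].
- by apply: sub_has hQ => r ->; rewrite /comparable_words prefix0s.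
- by apply: sub_has => r /andP[-> /comparable_words_parent].
- case/hasP => r rJ /andP[Qr /comparable_words_child[[] h]]; [right|left];
  by apply/hasP; exists r; rewrite ?Qr.
Qed.

(** * The trees of the even and of the odd pairs *)

Section CodeTree.
Variable J : seq (word * word).
Hypotheses (cJ1 : complete_code [seq r.1 | r <- J])
           (cJ2 : complete_code [seq r.2 | r <- J]).

Local Notation even_tree := (code_tree J (fun r => even_pair r)).
Local Notation odd_tree := (code_tree J (fun r => ~~ even_pair r)).

Let n := \max_(b <- [seq r.1 | r <- J]) size b.

Let size_n r : r \in J -> size r.1 <= n.
Proof. by move=> rJ; apply: leq_bigmax_seq => //; exact: map_f. Qed.

Let all_n : all (fun b => size b <= n) [seq r.1 | r <- J].
Proof. by apply/allP => _ /mapP[r rJ ->]; exact: size_n. Qed.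

Lemma code_tree_cover a : even_tree a || odd_tree a.
Proof.
have [b ab Lb] := long_extension [seq r.1 | r <- J] a.
have /hasP[c /mapP[r rJ ->] rb] : has (fun c => prefix c b) [seq r.1 | r <- J].
  by rewrite has_count cJ1.
have ar : comparable_words a r.1.
  have [ra|/ltnW ra] := leqP (size r.1) (size a).
    rewrite comparable_long //.
    case/prefixP: ab rb => d ->; rewrite !prefixE.
    by rewrite takel_cat.
  rewrite comparable_wordsC comparable_long //.
  case/prefixP: rb ab => d ->; rewrite !prefixE.
  by rewrite takel_cat.
by case: (boolP (even_pair r)) => e; apply/orP; [left|right];
  apply/hasP; exists r; rewrite ?e.
Qed.

(** Level [n] lies at or below all code words, so a vertex there has at most one of them as prefix
    and membership becomes a sum of zeros and ones. *)
Lemma code_tree_level Q a : size a = n ->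
  code_tree J Q a = \sum_(r <- J | Q r) prefix r.1 a :> nat.
Proof.
move=> an; have -> : \sum_(r <- J | Q r) prefix r.1 a =
    count (fun r => Q r && prefix r.1 a) J.
  rewrite -sum1_count [LHS]big_mkcond [RHS]big_mkcond.
  by apply: eq_bigr => r _; case: (Q r) (prefix _ _) => [] [].
have -> : code_tree J Q a = has (fun r => Q r && prefix r.1 a) J.
  by apply: eq_in_has => r rJ; rewrite comparable_long ?an ?size_n.
rewrite has_count; have : count (fun r => Q r && prefix r.1 a) J <= 1.
  have := cJ1 (a := a); rewrite an => /(_ all_n) <-; rewrite count_map.
  by apply: sub_count => r /andP[].
by case: count => [|[]].
Qed.

Lemma code_tree_disjoint : ~ overlap (even_tree, odd_tree) n.
Proof.
case=> a an /= /andP[/hasP[r rJ /andP[er ar]] /hasP[s sJ /andP[os as_]]].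
have sa : all (fun b => size b <= size a) [seq r.1 | r <- J] by rewrite an.
have rs : r.1 = s.1.
  apply: (complete_code_unique cJ1 sa); rewrite ?map_f //.
    by rewrite -comparable_long ?an ?size_n.
  by rewrite -comparable_long ?an ?size_n.
have urs : r = s; last by rewrite -urs er in os.
have := complete_code_uniq cJ1 => u1.
apply/eqP; rewrite -(nth_index r rJ) -(nth_index r sJ).
rewrite nth_uniq ?index_mem ?(map_uniq u1) //.
rewrite -(nth_uniq [::] _ _ u1) ?size_map ?index_mem //.
by rewrite !(nth_map r) ?index_mem // !nth_index // rs.
Qed.

(** Each odd pair [r] contributes [2 ^ (n - size r.1)] vertices; modulo 3 the total is [(-1) ^+ n]
    times the sign sum in [odd_pairs_signs]. *)
Lemma code_tree_count : 3 %| count odd_tree (words n).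
Proof.
have -> : count odd_tree (words n) =
    \sum_(r <- J | ~~ even_pair r) 2 ^ (n - size r.1).
  rewrite -sum1_count big_mkcond big_seq.
  rewrite (eq_bigr (fun a => \sum_(r <- J | ~~ even_pair r) prefix r.1 a : nat));
    last first.
    move=> a; rewrite mem_words => /eqP an.
    by rewrite -code_tree_level //; case: (code_tree _ _ a).
  rewrite -big_seq exchange_big big_seq_cond [RHS]big_seq_cond.
  apply: eq_bigr => r /andP[rJ _]; rewrite -count_prefix_words ?size_n //.
  by rewrite -sum1_count [RHS]big_mkcond; apply: eq_bigr => a _; case: prefix.
rewrite dvdn3E natr_sum big_seq_cond.
rewrite (eq_bigr (fun r => (-1) ^+ n * (-1) ^+ size r.1)%R); last first.
  by move=> r /andP[rJ _]; rewrite natr_exp2_sub_F3 ?size_n.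
by rewrite -big_seq_cond -mulr_sumr odd_pairs_signs // mulr0.
Qed.

Lemma clopen_code_tree : clopen_pair (even_tree, odd_tree).
Proof.
(* The first tree is nonempty: without even pairs the odd tree would contain all [2 ^ n] words of
   level [n], a number prime to 3. *)
have hE : has (fun r => even_pair r) J.
  apply: contraT => /hasPn nE; have := code_tree_count.
  rewrite (eq_in_count (a2 := predT)) ?count_predT ?size_words.
    by rewrite Euclid_dvdX.
  move=> a _; have := code_tree_cover a.
  case/orP => // /hasP[r /nE]; by move=> /negbTE ->.
split; last by exists n; [exact: code_tree_disjoint|exact: code_tree_count].
split; [|exact: code_tree_star|exact: code_tree_cover].
case: (code_tree_star J (fun r => even_pair r)) => // /(congr1 (@^~ [::])).
case/hasP: hE => r rJ er; rewrite /= => /hasPn/(_ r rJ).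
by rewrite er /comparable_words prefix0s.
Qed.

End CodeTree.

Lemma level_tree t n a : Sigma2_star t ->
  (forall b c, size b = n -> prefix b c -> t c = t b) ->
  t a = has (fun b => t b && comparable_words a b) (words n).
Proof.
move=> st text; apply/idP/hasP => [ta|[b]].
  have [an|/ltnW na] := leqP (size a) n.
    have [b [bn ab tb]] := star_extend st an ta.
    by exists b; rewrite ?mem_words ?bn // tb /comparable_words ab.
  exists (take n a); first by rewrite mem_words size_takel.
  by rewrite (star_prefix st _ ta) ?prefix_take // /comparable_words prefix_take orbT.
rewrite mem_words => /eqP bn /andP[tb /orP[ab|ba]].
  exact: star_prefix st _ _ ab tb.
by rewrite (text b a bn ba).
Qed.

(** * [Omega2] as the set of clopen pairs *)

Section Omega2.
Context (R : realType) (A : cstarAlgType R) (S : bool -> A).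
Hypothesis hS : is_cuntz2 S.

Lemma Omega2_of_index J : thompson_index S J ->
  Omega2 S (code_tree J (fun r => even_pair r), code_tree J (fun r => ~~ even_pair r)).
Proof.
move=> tJ; have pJ : presents S J (\sum_(p <- J) SS S p)%R by [].
exists (even_part S J * star (even_part S J))%R.
  by exists (\sum_(p <- J) SS S p)%R, J; split=> //; exact: presents_thompsonF pJ.
rewrite even_part_proj // sum_fstC //.
by congr (_, _); apply/funext => a; rewrite tree_of_sum_fst.
Qed.

Lemma Omega2_clopen p : Omega2 S p -> clopen_pair p.
Proof.
case=> _ [f [J [_ [tJ _] ->]]] <-; rewrite even_part_proj // sum_fstC //.
have treeE Q : Defs.tree_of S (\sum_(p <- J | Q p) Pword S p.1)%R = code_tree J Q.
  by apply/funext => a; rewrite tree_of_sum_fst.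
rewrite !treeE; apply: clopen_code_tree; first exact: (complete_fst hS tJ).
exact: (complete_snd hS tJ).
Qed.

Lemma clopen_Omega2 p : clopen_pair p -> Omega2 S p.
Proof.
(* One level below the separation level [m], siblings carry the same colour; this provides the
   repeat in [ys]. *)
case=> cp [m dm m3]; pose n := m.+1.
have dn : ~ overlap p n by move=> o; apply/dm/(overlap_leq cp (leqnSn m)).
have n3 : 3 %| count p.2 (words n) by rewrite (dvdn3_count_disjoint cp dm).
(* The depth parities wanted in the second tree: that of [n], flipped on the words of [p.2], so that
   exactly the words of [p.1] form even pairs. *)
pose ys := [seq odd n (+) p.2 a | a <- words n].
have rep : has_repeat ys.
  have [a [r [am e]]] := words_siblings m.
  exists [::], (odd n (+) p.2 a), [seq odd n (+) p.2 b | b <- r].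
  by rewrite /ys e /= !(disjoint_extend cp dm am (prefix_rcons _ _)).
clearbody n; have sum : sign_sum ys = ((-1) ^+ false)%R.
  (* Modulo 3 the sign of a bit [y] is [1 + y]. The sum is therefore [(-1) ^+ n] times [2 ^ n] plus
     the count, where the count vanishes and [2 ^ n] is [(-1) ^+ n]. *)
  rewrite /sign_sum big_map (eq_bigr (fun a => (-1) ^+ n * (1 + p.2 a)%N%:R)%R).
    rewrite -mulr_sumr -natr_sum big_split /= sum1_size size_words.
    have -> : (\sum_(a <- words n) p.2 a)%N = count p.2 (words n).
      by rewrite -sum1_count [RHS]big_mkcond.
    move: n3; rewrite dvdn3E natrD => /eqP ->.
    by rewrite natr_exp2_F3 addr0 -expr2 sqrr_sign.
  move=> a _; rewrite signr_addb signr_odd; congr (_ * _)%R.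
  by case: (p.2 a); apply/eqP.
have [u Eu] := realize_parities rep sum.
have su : size (leaves (full_tree n)) = size (leaves u).
  rewrite leaves_full_tree -[RHS](size_map (fun w => false (+) odd (size w))).
  by rewrite -leaf_paritiesE Eu size_map.
have := Omega2_of_index (zip_leaves_thompson su hS).
set J := zip_leaves _ _.
have evenJ r : r \in J -> even_pair r = p.1 r.1.
  case/(mem_zip_leaves su) => k; rewrite leaves_full_tree => kn -> /=.
  have an : size (nth [::] (words n) k) = n.
    by apply/eqP; rewrite -mem_words mem_nth.
  have kl : k < size (leaves u) by rewrite -su leaves_full_tree.
  have := congr1 (fun s => nth false s k) Eu.
  rewrite leaf_paritiesE !(nth_map [::]) //= an => ->.
  by rewrite (disjointE cp dn an); case: (odd n) (p.2 _) => [] [].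
(* All first coordinates of [J] have length [n], so a tree that is constant below level [n] is
   recovered from the words of that length it contains. *)
have codeE (Q : pred word) (t : subtrees) : Sigma2_star t ->
    (forall a b, size a = n -> prefix a b -> t b = t a) ->
    (forall b, size b = n -> Q b = t b) ->
    forall Q', {in J, forall r, Q' r = Q r.1} -> code_tree J Q' = t.
  move=> st text Qt Q' QQ; apply/funext => a; rewrite (level_tree a st text).
  have memJ r : r \in J -> size r.1 = n.
    case/(mem_zip_leaves su) => k; rewrite leaves_full_tree => kn -> /=.
    by apply/eqP; rewrite -mem_words mem_nth.
  apply/hasP/hasP => -[].
    move=> r rJ /andP[]; rewrite QQ // Qt ?memJ // => tr ar.
    by exists r.1; rewrite ?mem_words ?memJ // tr.
  move=> b bn /andP[tb ab]; have := bn; rewrite -leaves_full_tree => bl.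
  have uz : unzip1 (zip (leaves (full_tree n)) (leaves u)) = leaves (full_tree n).
    by rewrite unzip1_zip ?su.
  have [r rz eb] : exists2 r, r \in zip (leaves (full_tree n)) (leaves u) & b = r.1.
    by apply/mapP; rewrite -/(unzip1 _) uz.
  move: rz; rewrite -in_zip_leaves -/J => rJ.
  by exists r; rewrite // QQ // -eb Qt ?tb //; apply/eqP; rewrite -mem_words.
have [s1 s2 _] := cp.
rewrite (@codeE p.1 p.1 (or_introl s1) _ _ _ evenJ) //; last first.
  by move=> a b an /(disjoint_extend cp dn an) ->.
rewrite (@codeE (predC p.1) p.2 s2 _ _ (fun r => ~~ even_pair r)) //.
- by case: (p).
- by move=> a b an /(disjoint_extend cp dn an) ->.
- by move=> b bn; rewrite /= (disjointE cp dn bn) negbK.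
- by move=> r rJ; rewrite evenJ.
Qed.

End Omega2.

(** * Topology *)

Definition agree (n : nat) (p : subtrees * subtrees) : set (subtrees * subtrees) :=
  [set q | forall a, size a <= n -> q.1 a = p.1 a /\ q.2 a = p.2 a].

Lemma eval_nbhs (t : subtrees) (a : word) : nbhs t [set u | u a = t a].
Proof.
have := @proj_continuous word (fun=> bool) a t [set t a].
by apply; exact: discrete_set1.
Qed.

Lemma subtrees_nbhs (t : subtrees) (U : set subtrees) : nbhs t U ->
  exists n, [set u : subtrees | forall a, size a <= n -> u a = t a] `<=` U.
Proof.
pose B n := [set u : subtrees | forall a, size a <= n -> u a = t a].
have FB : Filter (filter_from [set: nat] B).
  apply: filter_from_filter; first by exists 0.
  move=> i j _ _; exists (maxn i j) => // u Bu; split=> a ai; apply: Bu.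
    by rewrite leq_max ai.
  by rewrite leq_max ai orbT.
(* The filter based on the sets [B n] converges to [t] in every coordinate, hence in the product
   topology. *)
suff cB : filter_from [set: nat] B --> t by move=> /cB[n _ nU]; exists n.
apply/cvg_sup => a V [_ [[W _ <-]] Wt WV]; exists (size a) => // u Bu.
by apply: WV; rewrite /= Bu.
Qed.

Lemma agree_nbhs n p : nbhs p (agree n p).
Proof.
have L (s : seq word) : nbhs p
    [set q : subtrees * subtrees | forall a, a \in s -> q.1 a = p.1 a /\ q.2 a = p.2 a].
  elim: s => [|b s IH]; first by apply: filterE => q.
  have nb : nbhs p [set q : subtrees * subtrees | q.1 b = p.1 b /\ q.2 b = p.2 b].
    exists ([set u : subtrees | u b = p.1 b], [set u : subtrees | u b = p.2 b]).
      by split; exact: eval_nbhs.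
    by move=> q [].
  apply: filterS (filterI nb IH) => q [qb qs] a.
  by rewrite inE => /predU1P[->|/qs].
apply: filterS (L (flatten [seq words k | k <- iota 0 n.+1])) => q H a an.
apply: H; apply/flatten_mapP; exists (size a).
  by rewrite mem_iota ltnS an.
by rewrite mem_words.
Qed.

Lemma nbhs_agreeP p U : nbhs p U <-> exists n, agree n p `<=` U.
Proof.
split=> [[[V W] [/subtrees_nbhs[m mV] /subtrees_nbhs[n nW]] VWU]|[n nU]]; last first.
  exact: filterS nU (agree_nbhs n p).
exists (maxn m n) => q H; apply: VWU; split.
  by apply: mV => a am; case: (H a); rewrite // leq_max am.
by apply: nW => a an; case: (H a); rewrite // leq_max an orbT.
Qed.

Lemma closure_agree (X : set (subtrees * subtrees)) p :
  closure X p <-> forall n, exists2 q, X q & agree n p q.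
Proof.
split=> [cX n|H U /nbhs_agreeP[n nU]].
  by have [q [Xq pq]] := cX _ (agree_nbhs n p); exists q.
by have [q Xq pq] := H n; exists q; split=> //; exact: nU.
Qed.

Lemma nbhs_set_type (T : topologicalType) (D : set T) (x : D) (U : set D) V :
  nbhs (set_val x) V -> (forall y : D, V (set_val y) -> U y) -> nbhs x U.
Proof.
move=> nV VU; have := @initial_continuous D T set_val x V nV.
by apply: (@filterS _ (nbhs x)) => y /VU.
Qed.

Lemma compact_set_type (T : topologicalType) (D : set T) :
  compact D -> compact [set: D].
Proof.
move=> cD F FF _.
have [|x [Dx cx]] := cD (set_val @ F) (fmap_proper_filter set_val FF).
  by apply: (@filterE _ F) => y; exact: set_valP.
exists (exist _ x (mem_set Dx)); split=> // U V FU [_ [[W oW <-]] /= Wx WV].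
have [y [[z Uz <-] Wz]] : (set_val @` U) `&` W !=set0.
  apply: cx; last exact: open_nbhs_nbhs.
  by apply: (@filterS _ F _ U _ _ FU) => z Uz; exists z.
by exists z; split=> //; exact: WV.
Qed.

Lemma disjoint_agree n p q : ~ overlap p n -> agree n p q -> ~ overlap q n.
Proof.
move=> dp pq [a an qa]; apply: dp; exists a => //.
by have [|<- <-] := pq a; rewrite ?an.
Qed.

(** Agreement transfers disjointness to [q], and a disjoint covering pair is determined by its level
    [n]. Disjoint pairs are thus isolated among all covering pairs. *)
Lemma disjoint_agree_eq n p q :
  covers p -> covers q -> ~ overlap p n -> agree n p q -> q = p.
Proof.
move=> cp cq dp pq; have dq := disjoint_agree dp pq.
case: p q cp cq dp pq dq => p1 p2 [q1 q2] cp cq dp pq dq.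
have [/= sp1 sp2 _] := cp; have [/= sq1 sq2 _] := cq.
have lev (b : word) : b \in words n -> q1 b = p1 b /\ q2 b = p2 b.
  by rewrite mem_words => /eqP bn; apply: pq; rewrite bn.
congr (_, _); apply/funext => a.
  rewrite (@level_tree q1 n a (or_introl sq1)).
    rewrite (@level_tree p1 n a (or_introl sp1)).
      by apply: eq_in_has => b /lev[-> _].
    by move=> b c bn /(disjoint_extend cp dp bn)[].
  by move=> b c bn /(disjoint_extend cq dq bn)[].
rewrite (@level_tree q2 n a sq2).
  rewrite (@level_tree p2 n a sp2).
    by apply: eq_in_has => b /lev[_ ->].
  by move=> b c bn /(disjoint_extend cp dp bn)[].
by move=> b c bn /(disjoint_extend cq dq bn)[].
Qed.

Lemma covers_closed p : Sigma2 p.1 -> Sigma2_star p.2 ->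
  (forall n, exists2 q, covers q & agree n p q) -> covers p.
Proof.
move=> s1 s2 H; split=> // a; have [q [_ _ cq] pq] := H (size a).
by have [<- <-] := pq a (leqnn _); exact: cq.
Qed.

Definition boundary_pairs : set (subtrees * subtrees) :=
  [set p | covers p /\ forall n, overlap p n].

(** A shared vertex excludes the empty tree as second component. *)
Lemma boundary_pairs_sub : boundary_pairs `<=` Sigma2 `*` Sigma2.
Proof.
move=> p [[s1 [//|p2] _] /(_ 0)[a _ /andP[_]]].
by rewrite [p.2]p2.
Qed.

Lemma closure_clopen_disjoint p n : closure clopen_pair p ->
  covers p -> ~ overlap p n -> clopen_pair p.
Proof.
move=> /closure_agree/(_ n)[q [cq [m dm m3]] pq] cp dn.
have e := disjoint_agree_eq cp cq dn pq.
by rewrite -e; split=> //; exists m.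
Qed.

Lemma clopen_pair_not_boundary p : clopen_pair p -> ~ boundary_pairs p.
Proof. by move=> [_ [n dn _]] [_ /(_ n)]. Qed.

(** The tree of the union of the cylinders of level [n] selected by [c]; the diagonal pairs make it
    an instance of [code_tree]. *)
Definition level_set (n : nat) (c : pred word) : subtrees :=
  code_tree [seq (b, b) | b <- words n] (fun r => c r.1).

Lemma level_setP n (c : pred word) a : reflect
  (exists b, [/\ size b = n, c b & comparable_words a b]) (level_set n c a).
Proof.
apply: (iffP hasP) => [[_ /mapP[b + ->] /andP[cb ab]]|[b [bn cb ab]]].
  by rewrite mem_words => /eqP bn; exists b.
exists (b, b); rewrite /= ?cb //; apply: map_f; by rewrite mem_words bn.
Qed.

Lemma level_setE n c a : size a = n -> level_set n c a = c a.
Proof.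
move=> an; apply/level_setP/idP => [[b [bn cb]]|ca]; last first.
  by exists a; rewrite /comparable_words prefix_refl.
rewrite comparable_long ?an ?bn // prefixE bn -an take_size => /eqP ->.
by [].
Qed.

Lemma level_set_cover n c a : level_set n c a || level_set n (predC c) a.
Proof.
have [b [bn ab]] : exists b : word, size b = n /\ comparable_words a b.
  have [an|/ltnW na] := leqP (size a) n.
    exists (a ++ nseq (n - size a) false); rewrite size_cat size_nseq subnKC //.
    by rewrite /comparable_words prefix_prefix.
  exists (take n a); rewrite size_takel //.
  by rewrite /comparable_words prefix_take orbT.
by apply/orP; case cb: (c b); [left|right]; apply/level_setP; exists b;
  rewrite /= ?cb.
Qed.

Lemma clopen_level_set n c : has (predC c) (words n) ->
  3 %| count c (words n) -> clopen_pair (level_set n (predC c), level_set n c).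
Proof.
move=> /hasP[b bn nb] c3; split; last first.
  exists n.
    by case=> a an /=; rewrite !level_setE //= => /andP[/negP].
  rewrite /= (eq_in_count (a2 := c)) // => a.
  by rewrite mem_words => /eqP/level_setE.
split=> /=; last by move=> a; rewrite orbC level_set_cover.
  case: (code_tree_star [seq (b, b) | b <- words n] (fun r => ~~ c r.1)) => //.
  move/(congr1 (@^~ b)); rewrite -[LHS]/(level_set n (predC c) b) level_setE.
    by move=> e; move: nb; rewrite e.
  by apply/eqP; rewrite -mem_words.
exact: code_tree_star.
Qed.

(** Trees without leaves are determined up to level [n] by their vertices of level [n], so it is
    enough to compare there. *)
Lemma level_set_agree (t : subtrees) n m c : Sigma2_star t -> n <= m ->
  (forall a, size a = n -> t a = has (fun b => c b && prefix a b) (words m)) ->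
  forall a, size a <= n -> level_set m c a = t a.
Proof.
move=> st nm H a an; apply/level_setP/idP => [[b [bm cb ab]]|ta].
  have ltb : size (take n b) = n by rewrite size_takel ?bm.
  have pab : prefix a b.
    by move: ab; rewrite comparable_wordsC comparable_long // bm (leq_trans an).
  apply: (@star_prefix _ st a (take n b)).
    case/prefixP: pab => d ->; rewrite take_cat; case: ltngtP an => // [na _|<- _].
      exact: prefix_prefix.
    by rewrite subnn take0 cats0 prefix_refl.
  rewrite H //; apply/hasP; exists b; first by rewrite mem_words bm.
  by rewrite cb prefix_take.
have [a' [an' aa' ta']] := star_extend st an ta.
move: ta'; rewrite H // => /hasP[b + /andP[cb a'b]]; rewrite mem_words => /eqP bm.
by exists b; rewrite /comparable_words (prefix_trans aa' a'b).
Qed.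

(** * Approximation of overlapping pairs by clopen pairs *)

Section Density.
Variables (p : subtrees * subtrees) (n : nat) (a0 : word).
Hypotheses (cp : covers p) (a0n : size a0 = n) (o1 : p.1 a0) (o2 : p.2 a0).

(* Both colours occur below every vertex shared by the two trees, and [k] of the
   four grandchildren of [a0] are coloured true: as k ranges over 1, 2, 3 this
   realizes every residue modulo 3. *)
Let pattern (k : nat) (a : word) (i j : bool) : bool :=
  if ~~ p.2 a then false else if ~~ p.1 a then true
  else if a == a0 then (if k == 1 then i && j else if k == 2 then i else i || j)
  else i.

Let weight k a := pattern k a false false + pattern k a true false +
   (pattern k a false true + pattern k a true true).

(** A word of length [n.+2] is read as a vertex of level [n] followed by two letters; on such words
    the default [false] is never reached. *)
Let colour k (b : word) := pattern k (take n b) (nth false b n) (nth false b n.+1).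

Let colourE k a i j : size a = n -> colour k (rcons (rcons a i) j) = pattern k a i j.
Proof.
move=> an; rewrite /colour -!cats1 -catA take_size_cat // !nth_cat an ltnn subnn.
by rewrite /= [n.+1 < n]ltnNge leqnSn subSnn.
Qed.

Let count_colour k :
  count (colour k) (words n.+2) = \sum_(a <- words n) weight k a.
Proof.
rewrite !count_words_rcons /weight !big_split /= addnACA.
have c i j : count (fun b => colour k (rcons (rcons b i) j)) (words n) =
    \sum_(a <- words n) pattern k a i j.
  rewrite -sum1_count [LHS]big_mkcond; apply: eq_big_seq => a.
  by rewrite mem_words => /eqP an; rewrite colourE.
by rewrite !c addnACA.
Qed.

Let weight0 k : 0 < k <= 3 -> weight k a0 = k.
Proof.
by rewrite /weight /pattern o1 o2 eqxx /=; case: k => [|[|[|[|]]]].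
Qed.

Let count_choice : exists2 k, 0 < k <= 3 & 3 %| count (colour k) (words n.+2).
Proof.
pose rest k := \sum_(a <- words n | a != a0) weight k a.
(* Only the pattern at [a0] depends on [k], so [rest 1] is the contribution of the other vertices
   for every [k]. This choice lies between 1 and 3 and completes it to a multiple of 3. *)
exists (3 - rest 1 %% 3).
  by case: (rest 1 %% 3) (ltn_pmod (rest 1) (isT : 0 < 3)) => [|[|[|]]].
rewrite count_colour (bigD1_seq a0) ?mem_words ?a0n ?words_uniq //= weight0; last first.
  by case: (rest 1 %% 3) (ltn_pmod (rest 1) (isT : 0 < 3)) => [|[|[|]]].
set k := 3 - _; have -> : \sum_(a <- words n | a != a0) weight k a = rest 1.
  by apply: eq_bigr => a /negbTE na; rewrite /weight /pattern na.
have r3 := ltnW (ltn_pmod (rest 1) (isT : 0 < 3)).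
by rewrite /k addnC {1}(divn_eq (rest 1) 3) -addnA subnKC // dvdn_addl // dvdn_mull.
Qed.

Let pattern_some k a : (exists i j, pattern k a i j) <-> p.2 a.
Proof.
rewrite /pattern; split=> [[i [j]]|p2]; first by case: (p.2 a).
by exists true, true; rewrite p2 /=; case: (p.1 a) (a == a0) => [] [] //;
  case: ifP => // _; case: ifP.
Qed.

Let pattern_not_all k a : (exists i j, ~~ pattern k a i j) <-> p.1 a.
Proof.
rewrite /pattern; split=> [[i [j]]|p1].
  by have [_ _ /(_ a)] := cp; case: (p.1 a) (p.2 a) => [] [].
exists false, false; rewrite p1 /=; case: (p.2 a) (a == a0) => [] [] //.
by case: ifP => // _; case: ifP.
Qed.

Lemma clopen_pair_dense : exists2 q, clopen_pair q & agree n p q.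
Proof.
have [k k3 c3] := count_choice.
have has_ext (c : pred word) a : size a = n ->
    (exists i j, c (rcons (rcons a i) j)) <->
    has (fun b => c b && prefix a b) (words n.+2).
  move=> an; split=> [[i [j cij]]|/hasP[b + /andP[cb /prefixP[d eb]]]].
    apply/hasP; exists (rcons (rcons a i) j).
      by rewrite mem_words !size_rcons an.
    by rewrite cij (prefix_trans (prefix_rcons a i) (prefix_rcons _ j)).
  rewrite mem_words eb size_cat an -addn2 eqn_add2l.
  case: d eb => [|i [|j [|]]] // eb _; exists i, j.
  by rewrite -!cats1 -catA -eb.
exists (level_set n.+2 (predC (colour k)), level_set n.+2 (colour k)).
  apply: clopen_level_set => //.
  have /(pattern_not_all k)[i [j nij]] := o1.
  apply/hasP; exists (rcons (rcons a0 i) j).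
    by rewrite mem_words !size_rcons a0n.
  by rewrite /= colourE.
have [s1 s2 _] := cp.
have nn : n <= n.+2 by rewrite (leq_trans (leqnSn n)).
move=> a an; split=> /=.
  apply: (level_set_agree (or_introl s1) nn) => // b bn.
  apply/idP/idP => [/(pattern_not_all k)[i [j h]]|/has_ext-/(_ bn)[i [j]]].
    by apply/has_ext => //; exists i, j; rewrite /= colourE.
  by rewrite /= colourE // => h; apply/(pattern_not_all k); exists i, j.
apply: (level_set_agree s2 nn) => // b bn.
apply/idP/idP => [/(pattern_some k)[i [j h]]|/has_ext-/(_ bn)[i [j]]].
  by apply/has_ext => //; exists i, j; rewrite colourE.
by rewrite colourE // => h; apply/(pattern_some k); exists i, j.
Qed.

End Density.

Lemma boundary_closure p : boundary_pairs p -> closure clopen_pair p.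
Proof.
case=> cp op; apply/closure_agree => n; have [a an /andP[o1 o2]] := op n.
exact: (clopen_pair_dense cp an o1 o2).
Qed.

(** * Modification of a tree below a vertex *)

Section Graft.
Variables (t : subtrees) (a0 : word) (s : subtrees).
Hypotheses (st : Sigma2 t) (ta0 : t a0) (sa0 : s a0).
Hypothesis s_parent : forall a i, s (rcons a i) -> s a.
Hypothesis s_child : forall a, s a -> exists i, s (rcons a i).

Definition graft : subtrees := fun a => if prefix a0 a then s a else t a.

Lemma graft_Sigma2 : Sigma2 graft.
Proof.
have [t0 tp tc] := st; rewrite /graft; split=> [|a i|a].
- by rewrite prefixs0; case: eqP => // e; rewrite -e.
- case: (boolP (prefix a0 a)) => [pa|npa].
    by rewrite (prefix_trans pa (prefix_rcons a i)) => /s_parent.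
  case: ifP => [pr _|_]; last exact: tp.
  have e : a0 = rcons a i.
    by move: pr; rewrite prefix_rconsE (negbTE npa) => /eqP.
  by apply: (tp a i); rewrite -e.
- case: (boolP (prefix a0 a)) => [pa|npa].
    move=> /s_child[i sai]; case: i sai => sai; [right|left];
    by rewrite (prefix_trans pa (prefix_rcons _ _)).
  move=> /tc[] h; [left|right]; case: ifP => // pr.
    by move: pr; rewrite prefix_rconsE (negbTE npa) => /eqP <-.
  by move: pr; rewrite prefix_rconsE (negbTE npa) => /eqP <-.
Qed.

(** The only vertex below [a0] of length at most [n] is [a0] itself, which both trees contain. *)
Lemma graft_agree n a : size a0 = n -> size a <= n -> graft a = t a.
Proof.
move=> a0n an; rewrite /graft; case: ifP => // /prefixP[d ed].
suff -> : a = a0 by rewrite ta0 sa0.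
move: an; rewrite ed size_cat a0n -{2}(addn0 n) leq_add2l leqn0 => /nilP ->.
by rewrite cats0.
Qed.

End Graft.

(** The tree of the projection [Pword S w]: the ancestors of [w] and all its descendants. *)
Definition tree_above (w : word) : subtrees := fun a => comparable_words a w.

(** The first tree becomes full below [a0], so covering holds whatever the second one does there;
    the two still meet along every branch through [w]. *)
Lemma boundary_graft (p : subtrees * subtrees) (n : nat) (a0 w : word) :
  boundary_pairs p -> size a0 = n -> p.1 a0 -> p.2 a0 -> prefix a0 w ->
  let q := (graft p.1 a0 (fun=> true), graft p.2 a0 (tree_above w)) in
  boundary_pairs q /\ agree n p q.
Proof.
move=> [[s1 s2 cov] ov] a0n o1 o2 a0w q.
have s2' : Sigma2 p.2 by case: s2 => // e; rewrite e in o2.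
have ta0 : tree_above w a0 by rewrite /tree_above /comparable_words a0w.
have cq : covers q.
  split=> /=.
  - by apply: graft_Sigma2 => // a _; exists true.
  - left; apply: graft_Sigma2 => // a; first by move=> i; exact: comparable_words_parent.
    exact: comparable_words_child.
  - by move=> a; rewrite /graft; case: (prefix a0 a).
split; last first.
  by move=> a an; split; apply: (@graft_agree _ a0 _ _ _ n).
split=> // m; apply: (@overlap_leq _ _ (size w + m) cq (leq_addl _ _)).
exists (w ++ nseq m false); first by rewrite size_cat size_nseq.
have pw : prefix a0 (w ++ nseq m false) by apply: prefix_trans a0w (prefix_prefix _ _).
by rewrite /= /graft pw /tree_above /comparable_words prefix_prefix orbT.
Qed.

Lemma boundary_pairs_full : boundary_pairs ((fun=> true), (fun=> true)).
Proof.
have sT : Sigma2 (fun=> true) by split=> // a; left.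
split; first by split=> //; left.
by move=> n; exists (nseq n false); rewrite ?size_nseq.
Qed.

(** Each condition, including the presence of both roots, concerns finitely many vertices and is
    read off from a sufficiently close approximant. *)
Lemma boundary_pairs_closed : closed boundary_pairs.
Proof.
move=> p /closure_agree cl.
have sub (sel : subtrees * subtrees -> subtrees) :
    (forall q, boundary_pairs q -> Sigma2 (sel q)) ->
    (forall n q, agree n p q -> forall a, size a <= n -> sel q a = sel p a) ->
    Sigma2 (sel p).
  move=> selS selA; split=> [|a i|a].
  - have [q /selS[qn _ _] /selA pq] := cl 0; by rewrite -pq.
  - have [q /selS[_ qp _] /selA pq] := cl (size a).+1.
    by rewrite -!pq ?size_rcons //; exact: qp.
  - have [q /selS[_ _ qc] /selA pq] := cl (size a).+1.
    by rewrite -!pq ?size_rcons //; exact: qc.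
have s1 : Sigma2 p.1.
  by apply: (sub fst) => [q /boundary_pairs_sub[]|n q pq a /pq[]].
have s2 : Sigma2 p.2.
  by apply: (sub snd) => [q /boundary_pairs_sub[]|n q pq a /pq[]].
split.
  by apply: covers_closed (or_introl s2) _ => // n; have [q [cq _] pq] := cl n; exists q.
move=> n; have [q [_ /(_ n)[a an qa]] pq] := cl n; exists a => //.
by have [|<- <-] := pq a; rewrite ?an.
Qed.

Lemma subtrees_compact : compact [set: subtrees].
Proof.
have := @tychonoff word (fun=> bool) (fun=> setT) (fun=> bool_compact).
by congr (compact _); rewrite eqEsubset.
Qed.

Lemma boundary_pairs_compact : compact boundary_pairs.
Proof.
apply: (subclosed_compact boundary_pairs_closed (B := setT)) => //.
by rewrite -setXTT; apply: compact_setX; exact: subtrees_compact.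
Qed.

(** Distinct pairs differ at some level [n]. Agreement up to level [n] is an equivalence relation
    with open classes, so each class is clopen. *)
Lemma boundary_zero_dimensional : zero_dimensional boundary_pairs.
Proof.
move=> x y xy.
have [n nxy] : exists n, ~ agree n (set_val x) (set_val y).
  apply: contrapT => /forallNP H; move/eqP: xy; apply; apply: val_inj.
  have E a := contrapT (H (size a)) a (leqnn _).
  rewrite -!set_valE [set_val x]surjective_pairing [set_val y]surjective_pairing.
  by congr (_, _); apply/funext => a; have [] := E a.
exists [set z : boundary_pairs | agree n (set_val x) (set_val z)]; split=> //.
have nb (z : boundary_pairs) : nbhs z [set z' : boundary_pairs |
    agree n (set_val z) (set_val z')].
  exact: (nbhs_set_type (agree_nbhs n (set_val z))).
have sw (z z' : boundary_pairs) : agree n (set_val z) (set_val z') ->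
    agree n (set_val x) (set_val z) <-> agree n (set_val x) (set_val z').
  move=> zz; split=> H a an; have [e1 e2] := zz a an; have [h1 h2] := H a an.
    by rewrite e1 e2.
  by rewrite -e1 -e2.
split.
  rewrite openE => z xz; apply: (@filterS _ (nbhs z) _ _ _ _ (nb z)) => z' /sw e.
  exact/e.
rewrite -openC openE => z xz; apply: (@filterS _ (nbhs z) _ _ _ _ (nb z)) => z' /sw e.
by move/e.
Qed.

Lemma zero_dimensional_hausdorff (T : topologicalType) :
  zero_dimensional T -> hausdorff_space T.
Proof.
move=> zT; rewrite open_hausdorff => x y /zT[U [[oU cU] Ux Uy]].
exists (U, ~` U); first by rewrite !inE.
by split=> //=; [rewrite openC|rewrite setICr].
Qed.

Lemma boundary_perfect : perfect_set [set: boundary_pairs].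
Proof.
apply/perfectTP => x; rewrite openE => /(_ x erefl).
rewrite /interior => -[_ [[W oW <-] Wx Wsub]].
have /nbhs_agreeP[n nW] : nbhs (set_val x) W by apply: open_nbhs_nbhs.
have bx : boundary_pairs (set_val x) by exact: set_valP.
have [a an /andP[o1 o2]] := bx.2 n.
have eqx w : prefix a w ->
    (graft (set_val x).1 a (fun=> true), graft (set_val x).2 a (tree_above w)) =
    set_val x.
  move=> aw; have [bq aq] := boundary_graft bx an o1 o2 aw.
  pose z : boundary_pairs := exist (fun q => q \in boundary_pairs) _ (mem_set bq).
  have zx : z = x by apply: Wsub; exact: nW.
  exact: (congr1 set_val zx).
(* If [x] were isolated, the grafts for [w = rcons a true] and [w = a] would both equal [x], but
   only the latter has [rcons a false] in its second tree. *)
have := etrans (eqx _ (prefix_rcons a true)) (esym (eqx _ (prefix_refl a))).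
move=> /(congr1 snd)/(congr1 (@^~ (rcons a false))) /=.
rewrite /graft prefix_rcons /tree_above !comparable_long ?size_rcons //.
rewrite prefix_rcons prefixE size_rcons take_oversize ?size_rcons //.
by rewrite eqseq_rcons andbF.
Qed.

Lemma boundary_cantor_like : cantor_like boundary_pairs.
Proof.
split; first exact: boundary_perfect.
- exact/compact_set_type/boundary_pairs_compact.
- exact/zero_dimensional_hausdorff/boundary_zero_dimensional.
- exact: boundary_zero_dimensional.
Qed.

Lemma cantor_like_homeomorphic (R : realType) (T : pseudoMetricType R) (x0 : T) :
  cantor_like T -> homeomorphic T cantor_space.
Proof.
move=> cT; pose PT : pseudoPMetricType R := HB.pack T (isPointed.Build T x0).
have [f [cf clf]] := @homeomorphism_cantor_like R PT cT.
have fK : cancel f (f^-1)%FUN by move=> x; exact: funK (mem_set I).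
have gK : cancel (f^-1)%FUN f by move=> x; exact: invK (mem_set I).
exists (f^-1)%FUN, f; split=> //.
(* Preimages under the inverse are images under [f], and [f] is a closed map. *)
apply/(@continuous_closedP PT) => C cC.
have -> : (f^-1)%FUN @^-1` C = f @` C; last exact: clf.
rewrite eqEsubset; split=> [x Cx|_ [c Cc <-]]; last by rewrite /= fK.
by exists (f^-1 x)%FUN.
Qed.

Lemma boundary_homeomorphic (R : realType) :
  homeomorphic boundary_pairs cantor_space.
Proof.
have x0 : boundary_pairs :=
  exist (fun p => p \in boundary_pairs) _ (mem_set boundary_pairs_full).
exact: (@cantor_like_homeomorphic R boundary_pairs x0 boundary_cantor_like).
Qed.

Theorem proposition3p4 (R : realType) (A : cstarAlgType R) (S : bool -> A)
    (hS : is_cuntz2 S) :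
  [/\ discrete_subspace (Omega2 S)
      /\ open_subspace (Omega2 S) (Omega2_closure S),
      Omega2_boundary S `<=` Sigma2 `*` Sigma2 &
      homeomorphic (Omega2_boundary S) cantor_space].
Proof.
have OE : Omega2 S = clopen_pair.
  by rewrite eqEsubset; split=> p; [exact: Omega2_clopen|exact: clopen_Omega2].
(* Covering passes to limits, and a disjoint limit coincides with one of its approximants. *)
have closureE p : Omega2_closure S p ->
    covers p /\ forall n, ~ overlap p n -> clopen_pair p.
  rewrite /Omega2_closure OE => -[clp [s1 s2]].
  have cp : covers p.
    apply: covers_closed s1 s2 _ => n.
    by have /closure_agree/(_ n)[q [cq _] pq] := clp; exists q.
  by split=> // n; exact: closure_clopen_disjoint.
have boundaryE : Omega2_boundary S = boundary_pairs.
  rewrite eqEsubset; split=> p.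
    rewrite /Omega2_boundary OE => -[/closureE[cp dp] np]; split=> // n.
    by apply: contrapT => /dp.
  move=> bp; split; last by rewrite OE => /clopen_pair_not_boundary.
  rewrite /Omega2_closure OE; split; first exact: boundary_closure.
  by case: bp => -[].
split; last 2 first.
- by rewrite boundaryE; exact: boundary_pairs_sub.
- by rewrite boundaryE; exact: (boundary_homeomorphic R).
split.
  (* At a level where the two trees of [x] are separated, agreement with [x] forces equality, so
     every singleton is open. *)
  move=> U; rewrite openE => x Ux.
  have := set_valP x; rewrite {1}OE => -[cx [n dx _]].
  apply: (nbhs_set_type (agree_nbhs n (set_val x))) => y xy.
  have : clopen_pair (set_val y) by rewrite -OE; exact: set_valP.
  case=> cy _; have /val_inj -> // : set_val y = set_val x.
  exact: disjoint_agree_eq xy.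
split=> [p Op|].
  split; first exact: subset_closure.
  by move: Op; rewrite OE => -[[]].
(* The same neighbourhood isolates [x] in the closure, since all points of the closure are covering
   pairs. *)
rewrite openE => x /=; rewrite OE => -[cx [n dx n3]].
apply: (nbhs_set_type (agree_nbhs n (set_val x))) => y xy /=.
have [cy _] := closureE _ (set_valP y).
have -> : set_val y = set_val x := disjoint_agree_eq cx cy dx xy; split=> //.
by exists n.
Qed.
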